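(* Let $1<q\le p<\infty$ and let $H:\mathbb{R}^N\to[0,+\infty)$ be a $C^1$ positively $p$-homogeneous convex function. Let $\Omega\subset\mathbb{R}^N$ be an open set. For every pair of differentiable functions $u,v:\Omega\to\mathbb{R}$ with $v\ge 0$ and $u>0$, one has, pointwise in $\Omega$, \[ \frac{1}{p}\,\left\langle\nabla H(\nabla u), \nabla \left(\frac{v^q}{u^{q-1}}\right)\right\rangle \le H(\nabla v)^\frac{q}{p}\, H(\nabla u)^\frac{p-q}{p}. \]
   Context: $H$ is positively $p$-homogeneous if $H(\lambda z)=\lambda^p H(z)$ for all $z\in\mathbb{R}^N$ and all real $\lambda\ge 0$ ($H$ is not assumed to be even). $\langle\cdot,\cdot\rangle$ is the Euclidean scalar product. When $q=p$ the factor $H(\nabla u)^{(p-q)/p}$ is understood to be $1$. *)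

(* Defs.v *)
From mathcomp Require Import all_boot all_order all_algebra.
From mathcomp Require Import all_classical all_reals all_analysis.
Import Order.TTheory GRing.Theory Num.Theory.
Import numFieldNormedType.Exports.

Set Implicit Arguments.
Unset Strict Implicit.
Unset Printing Implicit Defensive.

Local Open Scope classical_set_scope.
Local Open Scope ring_scope.

Definition dotprod (R : realType) (N : nat) (x y : 'rV[R]_N) : R :=
  \sum_(i < N) x 0 i * y 0 i.

(* The total operator 'D_v f x has an unspecified value when the directional
   derivative does not exist, so this vector is the gradient only at points
   where the partial derivatives of f exist. *)
Definition gradient (R : realType) (N : nat) (f : 'rV[R]_N -> R)
    (x : 'rV[R]_N) : 'rV[R]_N :=
  \row_(i < N) 'D_(delta_mx 0 i) f x.

Definition C1 (R : realType) (N : nat) (f : 'rV[R]_N -> R) : Prop :=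
  (forall x : 'rV[R]_N, differentiable f x) /\ continuous (gradient f).

(* Only nonnegative scalars occur: powR is the usual real power on [0, +oo[,
   with 0 `^ p = 0 for p != 0. *)
Definition pos_homogeneous (R : realType) (N : nat) (p : R)
    (f : 'rV[R]_N -> R) : Prop :=
  forall (lambda : R) (z : 'rV[R]_N),
    0 <= lambda -> f (lambda *: z) = lambda `^ p * f z.

(* Main.v *)
(* Write a = H(grad u)^(1/p), b = H(grad v)^(1/p) and w = v/u.  The tangent
   inequality of the convex function H at grad u, tested at t grad v, reads
   t <grad H(grad u), grad v> <= t^p b^p + (p - 1) a^p thanks to Euler's identity
   <grad H(z), z> = p H(z); optimizing in t >= 0 gives
   <grad H(grad u), grad v> <= p a^(p - 1) b.  Since
   grad (v^q/u^(q-1)) = q w^(q-1) grad v - (q - 1) w^q grad u, the claim becomes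
   a^(p-q) (q (w a)^(q-1) b - (q - 1) (w a)^q) <= a^(p-q) b^q,
   which is Young's inequality with exponent q. *)
Require Import Defs.
From mathcomp Require Import all_boot all_order all_algebra.
From mathcomp Require Import all_classical all_reals all_analysis.
From mathcomp Require Import ring lra.
Import Order.TTheory GRing.Theory Num.Theory.
Import numFieldNormedType.Exports.

Local Open Scope classical_set_scope.
Local Open Scope ring_scope.

(** * Directional derivatives *)

Lemma deriveE_dotprod (R : realType) (N : nat) (f : 'rV[R]_N -> R)
    (x w : 'rV[R]_N) :
  differentiable f x -> 'D_w f x = dotprod (gradient f x) w.
Proof.
move=> df; rewrite deriveE// {1}(row_sum_delta w) linear_sum/=.
apply: eq_bigr => i _.
by rewrite linearZ/= mxE deriveE// mulrC.
Qed.

(** Restriction to the line through [x] in direction [w] makes one-variable rules, such as the chain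
    rule, available for directional derivatives. *)
Lemma is_derive_line (R : realType) (V W : normedModType R) (f : V -> W)
    (x w : V) (df : W) :
  is_derive x w f df <-> is_derive (0 : R) 1 (fun h => f (h *: w + x)) df.
Proof.
have E : 'D_w f x = 'D_1 (fun h : R => f (h *: w + x)) 0.
  rewrite /derive; set g1 := fun h => _; set g2 := fun h => _.
  suff -> : g1 = g2 by [].
  apply/funext => h; rewrite /g1 /g2 /=.
  by rewrite addr0 scale0r add0r [_%:A]mulr1.
split=> -[dfx <-]; split.
- exact: (derivable1P _ _ _).1.
- by rewrite E.
- exact: (derivable1P _ _ _).2.
- by rewrite E.
Qed.

Lemma is_derive_powR (R : realType) (V : normedModType R) (f : V -> R)
    (a : R) (x w : V) (df : R) :
  0 < f x -> is_derive x w f df ->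
  is_derive x w (fun y => f y `^ a) (a * f x `^ (a - 1) * df).
Proof.
move=> fx0 /is_derive_line dfx; apply/is_derive_line.
have dp : is_derive (f ((0 : R) *: w + x)) 1 (@powR R ^~ a) (a * f x `^ (a - 1)).
  by rewrite scale0r add0r; exact: is_derive1_powR.
exact: (@is_derive1_comp R _ (fun h : R => f (h *: w + x)) _ _ _ dp dfx).
Qed.

(** * Convexity, homogeneity and inequalities for real powers *)

(** For 0 < h <= 1 convexity bounds the difference quotient along [y - x] by [f y - f x]. The bound
    passes to the limit from the right, which is the derivative because the two-sided limit
    exists. *)
Lemma convex_derive_le (R : realType) (V : normedModType R) (f : V -> R)
    (x y : V) :
  convex_function [set: V] f -> derivable f x (y - x) ->
  'D_(y - x) f x <= f y - f x.
Proof.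
move=> cf df.
have cr := cvg_dnbhs_at_right df.
rewrite -[leLHS]/(lim _) -(cvg_lim _ cr)//.
apply: limr_le; first by apply/cvg_ex; eexists; exact: cr.
near=> h.
have h0 : 0 < h by near: h; exact: nbhs_right_gt.
have h1 : h <= 1 by near: h; exact: nbhs_right_le.
have := cf (Itv01 (ltW h0) h1) y x (in_setT _) (in_setT _).
rewrite convRE /= => H.
rewrite /= -[_ *: _]/(_ * _) mulrC ler_pdivrMr//.
rewrite (_ : h *: (y - x) + x = h *: y + (1 - h) *: x); last first.
  by rewrite scalerBr scalerBl scale1r addrAC addrA.
rewrite /unstable.onem in H.
apply: (le_trans (lerB H (lexx (f x)))); nra.
Unshelve. all: by end_near. Qed.

Lemma cvg0_powR (R : realType) (T : Type) (F : set_system T) (FF : Filter F)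
    (f : T -> R) (r : R) :
  0 < r -> (\forall t \near F, 0 <= f t) -> f t @[t --> F] --> 0 ->
  f t `^ r @[t --> F] --> 0.
Proof.
move=> r0 f0 /cvgr0Pnorm_lt cf; apply/cvgr0Pnorm_lt => e e0.
have er0 : 0 < e `^ r^-1 by rewrite powR_gt0.
near=> t.
have ft0 : 0 <= f t by near: t.
have fte : `|f t| < e `^ r^-1 by near: t; exact: cf.
rewrite norm_powR// -[ltRHS]powRr1 ?(ltW e0)// -(mulVf (lt0r_neq0 r0)) powRrM.
by rewrite gt0_ltr_powR// nnegrE ltW.
Unshelve. all: by end_near. Qed.

(** Young's inequality for [b] and s^(q-1) with conjugate exponents q and q/(q-1), multiplied by
    q. *)
Lemma young_powR (R : realType) (q s b : R) :
  1 < q -> 0 <= s -> 0 <= b ->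
  q * s `^ (q - 1) * b <= b `^ q + (q - 1) * s `^ q.
Proof.
move=> q1 s0 b0.
have q10 : 0 < q - 1 by lra.
have q0 : 0 < q by lra.
have := @conjugate_powR R b (s `^ (q - 1)) q (q / (q - 1)) b0 (powR_ge0 _ _) q0.
move=> /(_ (divr_gt0 q0 q10)).
have -> : q^-1 + (q / (q - 1))^-1 = 1 by field; lra.
move=> /(_ erefl); rewrite -powRrM mulrCA divff ?mulr1; last lra.
rewrite -(ler_pM2l q0) mulrDr => H.
rewrite -mulrA [_ * b]mulrC; apply: (le_trans H).
suff <- : q * (b `^ q / q) + q * (s `^ q / (q / (q - 1))) = b `^ q + (q - 1) * s `^ q.
  by [].
by field; lra.
Qed.

(** Differentiate f(hx + x) = (h+1)^p f(x) at h = 0. Homogeneity for nonnegative scalars suffices,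
    since h + 1 > 0 for h near 0. *)
Lemma euler_homogeneous (R : realType) (N : nat) (p : R) (f : 'rV[R]_N -> R)
    (x : 'rV[R]_N) :
  pos_homogeneous p f -> derivable f x x -> 'D_x f x = p * f x.
Proof.
move=> hf /derivableP /is_derive_line df.
have dp : is_derive (0 : R) 1 (fun h : R => (h + 1) `^ p) (p * (0 + 1) `^ (p - 1) * (1 + 0)).
  by apply: is_derive_powR; rewrite ?add0r ?ltr01//; exact: is_deriveD.
have := @is_deriveM _ _ _ (cst (f x)) _ _ _ _ dp (is_derive_cst _ _ _).
rewrite scaler0 add0r add0r powR1 mulr1 addr0 mulr1 => dg.
have : is_derive (0 : R) 1 (fun h : R => f (h *: x + x)) (f x *: p).
  apply: near_eq_is_derive dg; near=> h.
  have h1 : -1 < h by near: h; apply: lt_nbhsr; rewrite ltrN10.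
  have -> : h *: x + x = (h + 1) *: x by rewrite scalerDl scale1r.
  by rewrite hf//; lra.
by case: df => _ <- [_ ->]; rewrite mulrC.
Unshelve. all: by end_near. Qed.

(** The right-hand side is the minimum of (t^p b^p + (p-1) a^p)/t over t > 0 when a, b > 0. If a or
    b vanishes it is 0, and c > 0 is excluded by a small t when a = 0, by a large t when b = 0. *)
Lemma slope_le_of_power_bound (R : realType) (p a b c : R) :
  1 < p -> 0 <= a -> 0 <= b ->
  (forall t : R, 0 <= t -> t * c <= t `^ p * b `^ p + (p - 1) * a `^ p) ->
  c <= p * a `^ (p - 1) * b.
Proof.
move=> p1 a0 b0 H.
have p0 : p != 0 by lra.
have [c0|c0] := leP c 0.
  by apply: (le_trans c0); rewrite !mulr_ge0 ?powR_ge0//; lra.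
have [b00|bn0] := eqVneq b 0.
  have pa0 : 0 <= (p - 1) * a `^ p by rewrite mulr_ge0 ?powR_ge0//; lra.
  (* With b = 0 the hypothesis reads t c <= (p-1) a^p; this t makes t c exceed that bound by c. *)
  have := H ((p - 1) * a `^ p / c + 1).
  have -> : ((p - 1) * a `^ p / c + 1) * c = (p - 1) * a `^ p + c by field; lra.
  rewrite b00 powR0// mulr0 add0r.
  have t0 : 0 <= (p - 1) * a `^ p / c + 1.
    by rewrite addr_ge0// divr_ge0// ltW.
  move=> /(_ t0); lra.
have bp : 0 < b by rewrite lt0r bn0.
have bpp : 0 < b `^ p by rewrite powR_gt0.
have [a00|an0] := eqVneq a 0.
  have q0 : p - 1 != 0 by lra.
  have d0 : 0 < c / (2 * b `^ p) by rewrite divr_gt0// mulr_gt0.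
  (* Chosen so that t^(p-1) b^p = c/2: the hypothesis becomes t c <= t c/2, which is absurd. *)
  set t := (c / (2 * b `^ p)) `^ (p - 1)^-1.
  have t0 : 0 < t by rewrite powR_gt0.
  have tp : t `^ p = t * (c / (2 * b `^ p)).
    rewrite -(@mulr_powRB1 R t p) ?(ltW t0)//; last lra.
    by rewrite /t -powRrM mulVf// powRr1 // ltW.
  have := H t (ltW t0).
  rewrite a00 powR0// mulr0 addr0 tp.
  have -> : t * (c / (2 * b `^ p)) * b `^ p = t * c / 2 by field; lra.
  have := mulr_gt0 t0 c0; lra.
have ap : 0 < a by rewrite lt0r an0.
(* The minimizer t = a/b, where t^p b^p = a^p and the bound is p a^p. *)
have := H (a / b) (divr_ge0 a0 b0).
rewrite -powRM ?divr_ge0// divfK//.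
rewrite -(@mulr_powRB1 R a p) ?(ltW ap)//; last lra.
rewrite mulrAC ler_pdivrMr// => H1.
rewrite -(ler_pM2l ap); apply: (le_trans H1).
suff <- : (a * a `^ (p - 1) + (p - 1) * (a * a `^ (p - 1))) * b
  = a * (p * a `^ (p - 1) * b) by [].
ring.
Qed.

(** * Derivative of the quotient v^q/u^(q-1) *)

(** Where v > 0 this is the product and chain rule. Writing the value in powers of v/u lets the same
    formula cover the zeros of v, where it gives 0 since q > 1. *)
Lemma is_derive_powR_quotient (R : realType) (V : normedModType R) (Omega : set V)
    (q : R) (u v : V -> R) (x w : V) :
  1 < q -> open Omega -> Omega x ->
  (forall y, Omega y -> 0 <= v y) -> (forall y, Omega y -> 0 < u y) ->
  differentiable u x -> differentiable v x ->
  is_derive x w (fun y => v y `^ q / u y `^ (q - 1))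
    (q * (v x / u x) `^ (q - 1) * 'D_w v x
     - (q - 1) * (v x / u x) `^ q * 'D_w u x).
Proof.
move=> q1 oO Ox v0 u0 du dv.
have dum : derivable u x w  by exact: diff_derivable.
have dvm : derivable v x w  by exact: diff_derivable.
have q0 : q != 0 by lra.
have q10 : q - 1 != 0 by lra.
have ux0 := u0 _ Ox.
have [vx0|vxn0] := eqVneq (v x) 0.
  (* [powR ^~ q] is not differentiable at 0, being constantly 1 on negative
     bases; nonnegativity of v around x is what makes the increment, written
     v * (v / u) `^ (q - 1), negligible. *)
  rewrite vx0 mul0r powR0// powR0// !(mulr0, mul0r) subr0.
  have cl : (fun h : R => h *: w + x) @ (0 : R)^' --> x.
    apply: cvg_within_filter; rewrite -{2}[x]add0r.
    by apply: cvgD; [rewrite -(scale0r w); exact: scalel_continuous | exact: cvg_cst].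
  have nO : \forall h \near (0 : R)^', Omega (h *: w + x).
    exact: (cl _ (open_nbhs_nbhs (conj oO Ox))).
  have cv := cvg_comp _ _ cl (differentiable_continuous dv).
  have cu := cvg_comp _ _ cl (differentiable_continuous du).
  have cq : (fun h : R => (v (h *: w + x) / u (h *: w + x)) `^ (q - 1))
      @ (0 : R)^' --> (0 : R).
    apply: cvg0_powR.
    - lra.
    - near=> h; have Oh : Omega (h *: w + x) by near: h.
      by rewrite divr_ge0 ?v0// ltW// u0.
    by have := cvgM cv (cvgV (lt0r_neq0 ux0) cu); rewrite vx0 mul0r; exact.
  have cF : (fun h : R => h^-1 *: (((fun y => v y `^ q / u y `^ (q - 1)) \o shift x)
       (h *: w) - v x `^ q / u x `^ (q - 1))) @ (0 : R)^' --> (0 : R).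
    (* The first factor converges to the derivative of [v] and the second to 0. *)
    have cM : (fun h : R => h^-1 *: ((v \o shift x) (h *: w) - v x) *
        (v (h *: w + x) / u (h *: w + x)) `^ (q - 1)) @ (0 : R)^' --> (0 : R).
      by rewrite -[X in _ --> X](mulr0 ('D_w v x)); apply: cvgM dvm cq.
    apply: (cvg_trans _ cM); apply: near_eq_cvg.
    near=> h; have Oh : Omega (h *: w + x) by near: h.
    have uh := u0 _ Oh; have vh := v0 _ Oh.
    rewrite /= vx0 powR0// mul0r !subr0 powRM ?invr_ge0 ?(ltW uh)//.
    rewrite -[(u _)^-1]powR_inv1 ?(ltW uh)// -powRrM mulN1r powRN.
    rewrite -(@mulr_powRB1 R _ q vh); last lra.
    by rewrite -scalerAl !mulrA.
  split; first by apply/cvg_ex; eexists; exact: cF.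
  exact: (cvg_lim _ cF).
have vp : 0 < v x by rewrite lt0r vxn0 v0.
have -> : (fun y => v y `^ q / u y `^ (q - 1)) =
   (fun y => v y `^ q) * (fun y => u y `^ (1 - q)).
  by apply/funext => y; rewrite [RHS]/GRing.mul/= -powRN opprB.
have := @is_deriveM _ _ _ _ _ _ _ _ (@is_derive_powR _ _ _ q _ _ _ vp (derivableP dvm))
  (@is_derive_powR _ _ _ (1 - q) _ _ _ ux0 (derivableP dum)).
move=> dF; apply: (is_derive_eq dF).
have e1 : u x `^ (1 - q) = (u x `^ (q - 1))^-1 by rewrite -powRN opprB.
have e2 : u x `^ (1 - q - 1) = (u x `^ q)^-1.
  by rewrite -powRN; congr (_ `^ _); ring.
have e3 r : (v x / u x) `^ r = v x `^ r / u x `^ r.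
  by rewrite powRM ?invr_ge0 ?(ltW vp) ?(ltW ux0)// -powR_inv1 ?(ltW ux0)//
    -powRrM mulN1r powRN.
rewrite !e3 e1 e2 -![_ *: _]/(_ * _); ring.
Unshelve. all: by end_near. Qed.

(** * The gradient inequality for H and the pointwise bound *)

Lemma dotprodBZr (R : realType) (N : nat) (g y z : 'rV[R]_N) (c d : R) :
  dotprod g (c *: y - d *: z) = c * dotprod g y - d * dotprod g z.
Proof.
rewrite /dotprod !mulr_sumr -sumrB; apply: eq_bigr => i _.
by rewrite !mxE; ring.
Qed.

(** Convexity tested at [t *: b], combined with Euler's identity at [a], is exactly the hypothesis
    of [slope_le_of_power_bound] for the p-th roots of [H a] and [H b]. *)
Lemma dotprod_gradient_le (R : realType) (N : nat) (p : R)
    (H : 'rV[R]_N -> R) (a b : 'rV[R]_N) :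
  1 < p -> (forall z, 0 <= H z) -> pos_homogeneous p H ->
  convex_function [set: 'rV[R]_N] H -> differentiable H a ->
  dotprod (gradient H a) b <=
    p * (H a `^ p^-1) `^ (p - 1) * H b `^ p^-1.
Proof.
move=> p1 H0 hH cH dH.
have p0 : p != 0 by lra.
have rootK z : (H z `^ p^-1) `^ p = H z by rewrite -powRrM mulVf// powRr1.
apply: slope_le_of_power_bound; rewrite ?powR_ge0// => t t0.
rewrite !rootK -hH//.
have := @convex_derive_le R _ H a (t *: b) cH (@diff_derivable _ _ _ _ _ _ dH).
rewrite deriveE_dotprod// -[X in _ - X]scale1r dotprodBZr.
rewrite -(deriveE_dotprod _ _ _ _ a)// (euler_homogeneous _ _ _ _ _ hH);
  last exact: diff_derivable.
lra.
Qed.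

Theorem proposition2p9 (R : realType) (N : nat) (p q : R)
  (q_gt1 : 1 < q) (q_le_p : q <= p)
  (H : 'rV[R]_N -> R)
  (H_ge0 : forall z : 'rV[R]_N, 0 <= H z)
  (H_C1 : C1 H)
  (H_hom : pos_homogeneous p H)
  (H_convex : convex_function [set: 'rV[R]_N] H)
  (Omega : set 'rV[R]_N) (Omega_open : open Omega)
  (u v : 'rV[R]_N -> R)
  (u_diff : forall x : 'rV[R]_N, Omega x -> differentiable u x)
  (v_diff : forall x : 'rV[R]_N, Omega x -> differentiable v x)
  (v_ge0 : forall x : 'rV[R]_N, Omega x -> 0 <= v x)
  (u_gt0 : forall x : 'rV[R]_N, Omega x -> 0 < u x) :
  forall x : 'rV[R]_N, Omega x ->
    p^-1 * dotprod (gradient H (gradient u x))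
                   (gradient (fun y => v y `^ q / u y `^ (q - 1)) x)
    <= H (gradient v x) `^ (q / p) * H (gradient u x) `^ ((p - q) / p).
Proof.
move=> x Ox.
have p_gt1 : 1 < p by lra.
have p_neq0 : p != 0 by lra.
have dH := H_C1.1 (gradient u x).
set w := v x / u x.
have w_ge0 : 0 <= w by rewrite divr_ge0 ?v_ge0// ltW// u_gt0.
have -> : gradient (fun y => v y `^ q / u y `^ (q - 1)) x =
    (q * w `^ (q - 1)) *: gradient v x - ((q - 1) * w `^ q) *: gradient u x.
  apply/rowP => i; rewrite !mxE.
  have dF := is_derive_powR_quotient _ _ _ _ _ _ _ (delta_mx 0 i) q_gt1
    Omega_open Ox v_ge0 u_gt0 (u_diff _ Ox) (v_diff _ Ox).
  exact: (@derive_val _ _ _ _ _ _ _ dF).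
rewrite dotprodBZr -(deriveE_dotprod _ _ _ _ (gradient u x))// (euler_homogeneous _ _ p)//; last first.
  exact: diff_derivable.
have := dotprod_gradient_le _ _ _ _ _ (gradient v x) p_gt1 H_ge0 H_hom H_convex dH.
set c := dotprod _ _.
rewrite (mulrC q p^-1) (mulrC (p - q)) !powRrM.
set b := H (gradient v x) `^ p^-1; set a := H (gradient u x) `^ p^-1 => c_le.
have -> : H (gradient u x) = a `^ p by rewrite -powRrM mulVf// powRr1.
have a_ge0 : 0 <= a by exact: powR_ge0.
have b_ge0 : 0 <= b by exact: powR_ge0.
clearbody a b w.
(* Since [a] may be 0, the exponent rule needs p - q + r nonzero, which r > 0 ensures. When p = q
   the factor a^(p-q) is 1, even at a = 0. *)
have ap r : 0 < r -> a `^ (p - q + r) = a `^ (p - q) * a `^ r.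
  by move=> r0; rewrite powRD//; apply/implyP => /eqP; lra.
have -> : p^-1 * (q * w `^ (q - 1) * c - (q - 1) * w `^ q * (p * a `^ p)) =
    p^-1 * (q * w `^ (q - 1)) * c - (q - 1) * w `^ q * a `^ p by field.
have k_ge0 : 0 <= p^-1 * (q * w `^ (q - 1)).
  by rewrite !mulr_ge0 ?powR_ge0 ?invr_ge0//; lra.
apply: le_trans (lerB (ler_wpM2l k_ge0 c_le) (lexx _)) _.
(* Young's inequality at s = w a, then multiplied by a^(p-q) >= 0. *)
have := young_powR _ q (w * a) b q_gt1 (mulr_ge0 w_ge0 a_ge0) b_ge0.
move=> /(ler_wpM2l (powR_ge0 a (p - q))).
rewrite !powRM//.
have q1_gt0 : 0 < q - 1 by lra.
have q_gt0 : 0 < q by lra.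
have -> : p - 1 = p - q + (q - 1) by ring.
have ap_split : a `^ p = a `^ (p - q) * a `^ q by rewrite -ap// subrK.
rewrite ap_split.
rewrite !ap//.
(* With the powers taken as atoms, the goal is a rearrangement of the multiplied Young
   inequality. *)
move: (a `^ (p - q)) (a `^ (q - 1)) (a `^ q) (w `^ q) (w `^ (q - 1)) (b `^ q).
move=> A1 A2 A3 W1 W2 B.
have -> : p^-1 * (q * W2) * (p * (A1 * A2) * b) = q * W2 * (A1 * A2) * b by field.
lra.
Qed.
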